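(* Let $n\ge 1$. For a Grand-Dyck path $P\in\mathcal{GD}_n$, let $\mathcal{A}$ be the set of positive peaks and negative valleys of $P$, and let $\mathcal{B}$ be the set of non-positive peaks, non-negative valleys and returns on the $x$-axis of $P$. Linearly order the elements of $\mathcal{A}$ and of $\mathcal{B}$ by their abscissas, and denote by $p_1,p_2,\ldots,p_h$ the absolute heights of the elements of $\mathcal{A}$ and by $v_1,v_2,\ldots,v_h$ the absolute heights of the elements of $\mathcal{B}$ (with $v_h=0$); all of these, including $h$, depend on $P$. Then $$\sum_{k=1}^{n}2^k t_{n,k}=\sum_{P\in\mathcal{GD}_n}\prod_{i=1}^{h}\binom{p_i-1}{v_i}.$$
   Context: A Grand-Dyck path of length $2n$ is a lattice path from $(0,0)$ to $(2n,0)$ using steps $U=(1,1)$ and $D=(1,-1)$; $\mathcal{GD}_n$ is the set of all of them. A peak is a pair of consecutive steps $UD$, a valley is a pair of consecutive steps $DU$; the height of a peak or valley is the ordinate of its vertex (the point between its two steps), and the absolute height is the absolute value of this ordinate. ''Positive'' means above the $x$-axis (height $>0$), ''negative'' means below the $x$-axis (height $<0$); non-positive means height $\le 0$ and non-negative means height $\ge 0$. A return is a point of the path, other than the starting point, lying on the $x$-axis (absolute height $0$). Elements of $\mathcal{A}$ and $\mathcal{B}$ are identified with the corresponding points (vertices) of the path, so that a peak or valley of height $0$, which is also a return, is counted once in $\mathcal{B}$. The sets $\mathcal A$ and $\mathcal B$ have the same cardinality $h$, and the last element of $\mathcal{B}$ is the final point $(2n,0)$. Given a set partition $\pi$ of $\{1,\ldots,n\}$,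 list its blocks $B_1|B_2|\cdots|B_m$ in increasing order of their maxima. One says that $\pi$ has $k$ components when the linearly ordered list of blocks can be partitioned into $k$ nonempty intervals (of consecutive blocks) such that the union of the blocks in each interval is an interval of integers in $\{1,\ldots,n\}$, and $k$ is maximum with this property. The number of set partitions of $\{1,\ldots,n\}$ having exactly $k$ components is denoted $t_{n,k}$. *)

(* Defs.v *)
From HB Require Import structures.
From mathcomp Require Import all_boot all_order all_algebra.

Set Implicit Arguments.
Unset Strict Implicit.
Unset Printing Implicit Defensive.

(* A lattice path starting at (0,0) is the sequence of its steps, with
   true = U = (1,1) and false = D = (1,-1). A vertex is given by its
   abscissa i, with 0 <= i <= size P. *)
Definition step (b : bool) : int := if b then 1%R else (-1)%R.

Definition height (P : seq bool) (i : nat) : int :=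
  (\sum_(b <- take i P) step b)%R.

Definition abs_height (P : seq bool) (i : nat) : nat := `|height P i|%N.

Definition grand_dyck (n : nat) (P : (n.*2).-tuple bool) : bool :=
  height P n.*2 == 0%R.

(* The vertex i lies between the steps number i.-1 and i (counted from 0); the
   bounds exclude the two endpoints, which are neither peaks nor valleys. *)
Definition peak (P : seq bool) (i : nat) : bool :=
  [&& 0 < i < size P, nth false P i.-1 == true & nth false P i == false].

Definition valley (P : seq bool) (i : nat) : bool :=
  [&& 0 < i < size P, nth false P i.-1 == false & nth false P i == true].

Definition return_pt (P : seq bool) (i : nat) : bool :=
  (0 < i <= size P) && (height P i == 0%R).

Definition in_A (P : seq bool) (i : nat) : bool :=
  (peak P i && (0 < height P i)%R) || (valley P i && (height P i < 0)%R).

Definition in_B (P : seq bool) (i : nat) : bool :=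
  [|| peak P i && (height P i <= 0)%R,
      valley P i && (0 <= height P i)%R
    | return_pt P i].

(* Absolute heights of the points of A and of B, by increasing abscissa. *)
Definition heights_A (P : seq bool) : seq nat :=
  [seq abs_height P i | i <- iota 0 (size P).+1 & in_A P i].

Definition heights_B (P : seq bool) : seq nat :=
  [seq abs_height P i | i <- iota 0 (size P).+1 & in_B P i].

(* Set partitions of {1, ..., n} are represented on 'I_n = {0, ..., n-1}. *)
Definition block_max (n : nat) (B : {set 'I_n}) : nat := \max_(x in B) x.

Definition blocks (n : nat) (pi : {set {set 'I_n}}) : seq {set 'I_n} :=
  sort (fun B C => block_max B <= block_max C) (enum pi).

Definition is_interval (n : nat) (S : {set 'I_n}) : bool :=
  [forall x in S, forall z in S, forall y : 'I_n, (x <= y <= z) ==> (y \in S)].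

(* A division of the list of blocks into k nonempty intervals of consecutive
   blocks is encoded by the sequence sh of the k lengths of these intervals. *)
Definition splits (n : nat) (pi : {set {set 'I_n}}) (k : nat) : bool :=
  [exists sh : k.-tuple 'I_#|pi|.+1,
    let lens := [seq val l | l <- sh] in
    [&& all (fun l => 0 < l) lens,
        sumn lens == size (blocks pi)
      & all (fun s => is_interval (\bigcup_(B <- s) B))
            (reshape lens (blocks pi))]].

Definition components (n : nat) (pi : {set {set 'I_n}}) : nat :=
  \max_(k < #|pi|.+1 | splits pi k) k.

Definition t (n k : nat) : nat :=
  #|[set pi : {set {set 'I_n}} | partition pi [set: 'I_n] & components pi == k]|.

(* Main.v *)
Require Import Defs.
From HB Require Import structures.
From mathcomp Require Import all_boot all_order all_algebra zify.

Set Implicit Arguments.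
Unset Strict Implicit.
Unset Printing Implicit Defensive.

(** Consider first a path that stays above the axis, with up-runs a_1, a_2, ...
  and down-runs d_1, d_2, ..., so that p_i and v_i are the heights reached after
  the i-th up-run and the i-th down-run. Such a path records the shape of a set
  partition whose blocks B_1, B_2, ... are listed by increasing maxima: take
  max B_i = a_1 + ... + a_i and |B_i| = d_i. When the maximum of B_i is read,
  p_i elements have been read and not yet put in an earlier block. The maximum
  is one of them; the rest of B_i is chosen among the other p_i - 1, and v_i of
  these are left over, so there are 'C(p_i - 1, v_i) choices. Hence the product
  of the binomials counts the partitions of that shape. Moreover v_i = 0 exactly
  when B_1, ..., B_i exhaust an initial segment, that is when a component ends,
  so returns of the path are components of the partition. Reflecting each of the
  k excursions of a Grand-Dyck path independently about the axis leaves the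
  weight unchanged and accounts for the factor 2 ^ k.

  Rather than through this correspondence, the equality is obtained from one
  recurrence, [completions], that both sides satisfy when elements of the
  partition, or up steps of the path, are consumed one at a time. Its two
  arguments are the number of elements still to be read and the number v of
  elements read but still waiting for their block, which is the height of the
  path.

  For paths, [binprod_scan_weight] identifies the product of binomials with a
  weight [scan_weight] computed in one left-to-right scan, and [scan_total_rec]
  sums that weight over all continuations. For partitions, [cut_sum_step]
  removes the block that the next element closes, if there is one, and
  [cut_sum_completions] concludes by induction. Finally [components_cuts]
  replaces the maximum in the definition of the number of components by the
  number of cuts, the c < n such that no block has elements both below c and
  from c on; the product of a factor 2 for each cut can then be peeled off one
  element at a time. *)

(** * The common recurrence *)

(** The next element either closes a block, leaving u of the v waiting elements
  waiting, or starts to wait itself. When nothing is waiting, a new component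
  starts; this is where its factor 2 is paid. *)
Fixpoint completions (m v : nat) : nat :=
  if m is m'.+1 then
    2 ^ (v == 0) *
    (\sum_(u < v.+1) 'C(v, u) * completions m' u + completions m' v.+1)
  else v == 0.

(** * Weights of paths by a left-to-right scan *)

(** The state of the scan: e is the side of the axis (true for above), h the
  distance to the axis, and q the absolute height of the last element of A while
  its partner in B has not been met, with q = 0 while the path moves away from
  the axis. On the axis e and q can be forgotten, because a return contributes
  the factor 'C(q - 1, 0) = 1. Paths that do not end on the axis get weight 0,
  so that no condition on the endpoint remains in the sums. *)
Fixpoint scan_weight (e : bool) (q h : nat) (s : seq bool) : nat :=
  if s is c :: s' then
    if h == 0 then scan_weight c 0 1 s'
    else if c == e then (if q == 0 then 1 else 'C(q.-1, h)) * scan_weight e 0 h.+1 s'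
    else scan_weight e (if q == 0 then h else q) h.-1 s'
  else h == 0.

Definition scan_total e q h l := \sum_(s : l.-tuple bool) scan_weight e q h s.

Lemma big_tuple_cons l (F : seq bool -> nat) :
  \sum_(s : l.+1.-tuple bool) F s = \sum_c \sum_(s : l.-tuple bool) F (c :: s).
Proof.
rewrite pair_big /=.
rewrite (reindex (fun p : bool * l.-tuple bool => [tuple of p.1 :: p.2])) //=.
exists (fun s => (thead s, [tuple of behead s])) => [[c s] _|s _] /=.
  by congr (_, _); apply: val_inj.
by rewrite [RHS]tuple_eta; apply: val_inj.
Qed.

Lemma scan_weight_short e q h s : size s < h -> scan_weight e q h s = 0.
Proof.
elim: s e q h => [|c s IH] e q [|h] //= hs.
by case: ifP => _; rewrite IH ?muln0 //=; lia.
Qed.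

Lemma scan_total_short e q h l : l < h -> scan_total e q h l = 0.
Proof. by move=> hl; apply: big1 => s _; rewrite scan_weight_short ?size_tuple. Qed.

Lemma scan_total0 e q h : scan_total e q h 0 = (h == 0).
Proof. by rewrite /scan_total (big_pred1 [tuple]) // => s; apply/esym/eqP/tuple0. Qed.

Lemma scan_totalS_axis e q l :
  scan_total e q 0 l.+1 = scan_total true 0 1 l + scan_total false 0 1 l.
Proof. by rewrite /scan_total big_tuple_cons big_bool. Qed.

Lemma scan_totalS e q h l :
  scan_total e q h.+1 l.+1 =
  (if q == 0 then 1 else 'C(q.-1, h.+1)) * scan_total e 0 h.+2 l +
  scan_total e (if q == 0 then h.+1 else q) h l.
Proof.
rewrite /scan_total big_tuple_cons big_bool /=.
by case: e => /=; rewrite big_distrr //= addnC.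
Qed.

(** In a path that ends on the axis, m counts the steps still to be made away
  from the axis. Once a path is coming back from an element of A of height q + 1,
  the next element of B may have any height u up to the present height h, and
  the pair contributes 'C(q, u). A path moving away at height h + 1 either turns
  back there, making this height an element of A, or goes on. The totals do not
  depend on the side e, which is why leaving the axis only costs a factor 2. *)
Lemma scan_total_rec l e :
  (forall m h, l = m.*2 + h.+1 ->
    scan_total e 0 h.+1 l =
      \sum_(u < h.+1) 'C(h, u) * completions m u + completions m h.+1) /\
  (forall m h q, l = m.*2 + h ->
    scan_total e q.+1 h l = \sum_(u < h.+1) 'C(q, u) * completions m u).
Proof.
elim: l e => [|l IH] e.
  split=> [m h|m h q lE]; first by lia.
  have [-> ->] : m = 0 /\ h = 0 by lia.
  by rewrite scan_total0 big_ord1 bin0.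
(* For m = 0 the path is too far from the axis to come back in l steps. *)
have up m h : l = m.*2 + h -> scan_total e 0 h.+2 l = completions m h.+1.
  case: m => [|m] lE; first by rewrite scan_total_short //; lia.
  by rewrite (proj1 (IH e) m) /= ?expn0 ?mul1n //; lia.
split=> [m h lE|m [|h] q lE].
- by rewrite scan_totalS /= mul1n (up m) ?(proj2 (IH e) m) 1?addnC //; lia.
- rewrite scan_totalS_axis; case: m lE => [|m] lE; first by lia.
  have {}lE : l = m.*2 + 1 by lia.
  rewrite !(proj1 (IH _) m 0) // !big_ord1 /= big_ord1.
  by rewrite !bin0 !mul1n expn1 mul2n addnn.
rewrite scan_totalS /= (up m) ?(proj2 (IH e) m) 1?[RHS]big_ord_recr 1?addnC //; lia.
Qed.

Lemma scan_total_completions n e q : scan_total e q 0 n.*2 = completions n 0.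
Proof.
case: n => [|n]; first by rewrite scan_total0.
rewrite doubleS scan_totalS_axis !(proj1 (scan_total_rec _ _) n 0) ?addn1 //=.
by rewrite expn1 mul2n addnn.
Qed.

(** * Heights of peaks, valleys and returns along a scan *)

Definition signed_height (e : bool) (h : nat) : int :=
  (if e then Posz h else - Posz h)%R.

(** Here z is the ordinate of the current vertex, b the step that leads to it,
  and s the rest of the path. With b at hand, membership of a vertex in A or B
  depends on the next step only. *)
Fixpoint later_A (z : int) (b : bool) (s : seq bool) : seq nat :=
  if s is c :: s' then
    (if (b && ~~ c && (0 < z)%R) || (~~ b && c && (z < 0)%R)
     then [:: `|z|%N] else [::]) ++ later_A (z + step c) c s'
  else [::].

Fixpoint later_B (z : int) (b : bool) (s : seq bool) : seq nat :=
  if s is c :: s' then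
    (if [|| b && ~~ c && (z <= 0)%R, ~~ b && c && (0 <= z)%R | z == 0%R]
     then [:: `|z|%N] else [::]) ++ later_B (z + step c) c s'
  else if z == 0%R then [:: 0] else [::].

Lemma heightS pre b s :
  height (pre ++ b :: s) (size pre).+1 = (height (pre ++ b :: s) (size pre) + step b)%R.
Proof.
rewrite /height -{1}cat_rcons (take_size_cat _ (s1 := rcons pre b)) ?size_rcons //.
by rewrite take_size_cat // big_rcons.
Qed.

(** The predicates [in_A] and [in_B] refer to positions in the whole path; the
  part already scanned is kept as the prefix [rcons pre b] so that they can be
  evaluated locally. *)
Lemma heights_later pre b s
    (P := pre ++ b :: s) (i := (size pre).+1) (k := (size s).+1) :
  [seq abs_height P j | j <- iota i k & in_A P j] = later_A (height P i) b s /\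
  [seq abs_height P j | j <- iota i k & in_B P j] = later_B (height P i) b s.
Proof.
rewrite /i /k /P {P i k}; elim: s pre b => [|c s IH] pre b.
  rewrite /= /in_A /in_B /peak /valley /return_pt size_cat /= addn1 ltnn /= leqnn /=.
  by case: ifP => //= /eqP h0; rewrite /abs_height h0.
have := IH (rcons pre b) c; rewrite cat_rcons size_rcons; set P := pre ++ _.
have hS : height P (size pre).+2 = (height P (size pre).+1 + step c)%R.
  have := heightS (rcons pre b) c s; rewrite cat_rcons size_rcons; exact.
have nb : nth false P (size pre) = b by rewrite nth_cat ltnn subnn.
have nc : nth false P (size pre).+1 = c.
  by rewrite nth_cat ltnNge leqnSn /= subSnn.
have sP : size P = size pre + (size s).+2 by rewrite size_cat.
move=> -[EA EB].
have inA : in_A P (size pre).+1 =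
  (b && ~~ c && (0 < height P (size pre).+1)%R) ||
  (~~ b && c && (height P (size pre).+1 < 0)%R).
  rewrite /in_A /peak /valley /= nb nc sP.
  have -> : (size pre).+1 < size pre + (size s).+2 by lia.
  by case: (b); case: (c).
have inB : in_B P (size pre).+1 =
  [|| b && ~~ c && (height P (size pre).+1 <= 0)%R,
      ~~ b && c && (0 <= height P (size pre).+1)%R
    | height P (size pre).+1 == 0%R].
  rewrite /in_B /peak /valley /return_pt /= nb nc sP.
  have -> : (size pre).+1 < size pre + (size s).+2 by lia.
  have -> : size pre < size pre + (size s).+2 by lia.
  by case: (b); case: (c).
rewrite [size (c :: s)]/= -[iota _ _]/((size pre).+1 :: iota (size pre).+2 (size s).+1).
rewrite [later_A _ _ _]/= [later_B _ _ _]/= -hS -EA -EB -inA -inB.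
by split; [case Ei: (in_A _ _)|case Ei: (in_B _ _)]; rewrite [filter _ _]/= Ei.
Qed.

Lemma heights_cons c s :
  heights_A (c :: s) = later_A (step c) c s /\
  heights_B (c :: s) = later_B (step c) c s.
Proof.
have [] := heights_later [::] c s; rewrite /heights_A /heights_B /=.
have -> : height (c :: s) 1 = step c by rewrite /height /= take0 big_seq1.
by [].
Qed.

Definition binprod (A B : seq nat) : nat :=
  \prod_(i < size A) 'C((nth 0 A i).-1, nth 0 B i).

Lemma binprod_cons a A b B :
  binprod (a :: A) (b :: B) = 'C(a.-1, b) * binprod A B.
Proof. by rewrite /binprod big_ord_recl. Qed.

(** Elements of A and of B alternate, starting with A: moving away from the axis
  ends at an element of A, and coming back ends at an element of B. Hence the
  i-th elements of the two lists are neighbours, and the scan has at most one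
  element of A waiting for its partner; in the second statement it is the one of
  height q + 1 added in front of the list. *)
Lemma binprod_scan_weight s e q h (z := signed_height e h)
    (closes := (z + \sum_(c <- s) step c)%R == 0%R) :
  (0 < h ->
    closes * binprod (later_A z e s) (later_B z e s) = scan_weight e 0 h s) /\
  closes * binprod (q.+1 :: later_A z (~~ e) s) (later_B z (~~ e) s) =
    scan_weight e q.+1 h s.
Proof.
rewrite /closes /z {z closes}; elim: s e q h => [|c s IH] e q h.
  rewrite big_nil GRing.addr0 /=.
  have -> : (signed_height e h == 0%R) = (h == 0).
    by rewrite /signed_height; case: e; lia.
  split; first by case: h.
  case: h => [|h] /=; last by [].
  by rewrite mul1n /binprod big_ord1 bin0.
rewrite big_cons GRing.addrA /=.
case: h => [|h].
  split=> //.
  have -> : signed_height e 0 = 0%R by case: e.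
  have [/(_ isT) <- _] := IH c 0 1.
  have -> : (0 + step c)%R = signed_height c 1 by case: c.
  by rewrite !Order.POrderTheory.ltxx !andbF /= eqxx !orbT /= binprod_cons bin0 mul1n.
have sE b : (signed_height e h.+1 + step b)%R =
    signed_height e (if b == e then h.+2 else h).
  by rewrite /signed_height /step; case: (b); case: (e) => /=; lia.
have sN : (0 < signed_height e h.+1)%R = e by rewrite /signed_height; case: (e); lia.
have sP : (signed_height e h.+1 < 0)%R = ~~ e.
  by rewrite /signed_height; case: (e); lia.
have sN' : (0 <= signed_height e h.+1)%R = e.
  by rewrite /signed_height; case: (e); lia.
have sP' : (signed_height e h.+1 <= 0)%R = ~~ e.
  by rewrite /signed_height; case: (e); lia.
have s0 : (signed_height e h.+1 == 0)%R = false.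
  by rewrite /signed_height; case: (e); lia.
have sA : `|signed_height e h.+1|%N = h.+1.
  by rewrite /signed_height; case: (e); lia.
rewrite sE sN sP sN' sP' s0 sA.
case: (eqVneq c e) => [->|ce].
  have [/(_ isT) IHe _] := IH e q h.+2.
  split=> [_|]; rewrite ?mul1n -IHe; case: (e) => //=;
  by rewrite binprod_cons mulnCA.
have -> : c = ~~ e by case: (c) (e) ce => [] [].
split=> [_|].
  have [_ <-] := IH e h h.
  by case: (e).
by have [_ <-] := IH e q h; case: (e).
Qed.

Lemma sum_grand_dyck n : 1 <= n ->
  \sum_(P : (n.*2).-tuple bool | grand_dyck P)
    \prod_(i < size (heights_A P))
      'C((nth 0 (heights_A P) i).-1, nth 0 (heights_B P) i) = completions n 0.
Proof.
move=> n0; rewrite -(scan_total_completions n true 0) /scan_total big_mkcond /=.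
apply: eq_bigr => P _; rewrite -/(binprod _ _).
have -> : grand_dyck P = (\sum_(d <- P) step d == 0)%R.
  by rewrite /grand_dyck /height take_oversize ?size_tuple.
case: P => -[|c s] /= sP; first by move: sP n0; rewrite eq_sym double_eq0 => /eqP->.
have [-> ->] := heights_cons c s.
have [/(_ isT) <- _] := binprod_scan_weight s c 0 1.
rewrite big_cons.
have -> : signed_height c 1 = step c by case: (c).
by case: ifP; rewrite ?mul1n.
Qed.

(** * Cuts of a set partition *)

Definition below n (c : nat) : {set 'I_n} := [set x : 'I_n | x < c].
Arguments below {n} c.

(** For a partition of the whole of 'I_n, these are the c at which one component
  ends and the next one starts, together with 0 and every c >= n. Hence the cuts
  c < n are the starting points of the components. *)
Definition cut n (pi : {set {set 'I_n}}) (c : nat) : bool :=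
  [forall B in pi, (B \subset below c) || [disjoint B & below c]].

Lemma below_mono n c d : c <= d -> below c \subset (below d : {set 'I_n}).
Proof. by move=> cd; apply/subsetP => x; rewrite !inE => /leq_trans; apply. Qed.

Lemma below_ord n (j : 'I_n) : below j.+1 = j |: below j.
Proof. by apply/setP => x; rewrite !inE -val_eqE /= ltnS leq_eqVlt. Qed.

Lemma below_all n c : n <= c -> below c = [set: 'I_n].
Proof. by move=> nc; apply/setP => x; rewrite !inE (leq_trans (ltn_ord x)). Qed.

Lemma cut_setU1 n (C : {set 'I_n}) pi c :
  C \subset below c -> cut (C |: pi) c = cut pi c.
Proof.
move=> sC; apply/forall_inP/forall_inP => H B Bpi.
  by apply: H; rewrite inE Bpi orbT.
by case/setU1P: Bpi => [->|/H //]; rewrite sC.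
Qed.

Lemma below0 n : below 0 = set0 :> {set 'I_n}.
Proof. by apply/setP => x; rewrite !inE. Qed.

Lemma cut0 n (pi : {set {set 'I_n}}) : cut pi 0.
Proof. by apply/forall_inP => B _; rewrite below0 -setI_eq0 setI0 eqxx orbT. Qed.

(** * Summing over partitions one element at a time *)

(** The situation after the elements below j have been read: D consists of the
  elements that are not in a closed block, and every block of pi still waits for
  its maximum, hence contains an element from j on. *)
Definition open_partition n (D : {set 'I_n}) (j : nat) (pi : {set {set 'I_n}}) :=
  partition pi D && [forall B in pi, ~~ (B \subset below j)].

Definition cut_sum n (D : {set 'I_n}) (j : nat) : nat :=
  \sum_(pi | open_partition D j pi) \prod_(j <= c < n) 2 ^ cut pi c.

Lemma sum_over_subsets (T : finType) (E : {set T}) (f : nat -> nat) :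
  \sum_(B : {set T} | B \subset E) f #|E :\: B| =
  \sum_(u < #|E|.+1) 'C(#|E|, u) * f u.
Proof.
rewrite (reindex_onto (fun B : {set T} => E :\: B) (fun B : {set T} => E :\: B))
  => [|B /setIidPr sBE]; last first.
  by rewrite setDDr setDv set0U sBE.
rewrite (eq_bigl (fun B : {set T} => B \subset E)) => [|B]; last first.
  by rewrite subsetDl /= setDDr setDv set0U; apply/eqP/idP => /setIidPr.
rewrite (partition_big (fun B : {set T} => inord #|B| : 'I_#|E|.+1) predT) //=.
apply: eq_bigr => u _.
rewrite (eq_big
  (fun B : {set T} => B \in [set A : {set T} | A \subset E & #|A| == u])
  (fun=> f u)).
- by rewrite sum_nat_const cards_draws.
- move=> B; rewrite inE; case sBE: (B \subset E) => //=.
  by rewrite -val_eqE /= inordK // ltnS subset_leq_card.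
- move=> B /andP[sBE /eqP <-].
  rewrite inordK ?ltnS ?subset_leq_card //.
  by rewrite setDDr setDv set0U (setIidPr sBE).
Qed.

(** No block of an open partition lies below j, so at a cut every block is
  disjoint from what lies below j: nothing is waiting. *)
Lemma cut_open n (D : {set 'I_n}) j pi :
  open_partition D j pi -> cut pi j = (#|D :&: below j| == 0).
Proof.
case/andP=> pD /forall_inP op.
rewrite cards_eq0 setI_eq0 disjoint_sym -(cover_partition pD).
apply/forall_inP/bigcup_disjointP => H B Bpi; last by rewrite disjoint_sym H ?orbT.
by have := H B Bpi; rewrite (negPf (op B Bpi)) disjoint_sym.
Qed.

Section Step.
Variables (n : nat) (D : {set 'I_n}) (j : 'I_n).
Hypothesis sD : ~: below j \subset D.

Let jD : j \in D.
Proof. by apply: (subsetP sD); rewrite !inE ltnn. Qed.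

(** Only the block of j can have j as its maximum, so if it does not, every block
  still contains an element from j + 1 on. *)
Lemma open_succ pi :
  open_partition D j pi && ~~ (pblock pi j \subset below j.+1) =
  open_partition D j.+1 pi.
Proof.
rewrite /open_partition; case pD: (partition pi D) => //=.
have tI : trivIset pi by case/and3P: pD.
have jc : j \in cover pi by rewrite (cover_partition pD).
apply/andP/forall_inP => [[/forall_inP op nj] B Bpi|op].
  apply: contra nj => sB; rewrite (def_pblock tI Bpi) //.
  have [x xB] := subsetPn (op B Bpi).
  have := subsetP sB x xB.
  by rewrite below_ord in_setU1 => /orP[/eqP <-|->].
split; last by rewrite op ?pblock_mem.
apply/forall_inP => B Bpi; apply: contra (op B Bpi) => /subset_trans; apply.
exact: below_mono.
Qed.

(** The left-hand side is the condition under which removing the block with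
  maximum j, which is j together with a set B of waiting elements, can be undone
  by adding that block. *)
Lemma open_close (B : {set 'I_n}) pi :
  B \subset D :&: below j ->
  (open_partition D j (j |: B |: pi) && (pblock (j |: B |: pi) j == j |: B))
    && ((j |: B |: pi) :\ (j |: B) == pi) =
  open_partition (D :\: (j |: B)) j.+1 pi.
Proof.
rewrite subsetI => /andP[BD Bj]; set C := j |: B.
have jC : j \in C by rewrite setU11.
have CD : C \subset D by rewrite subUset sub1set jD.
apply/andP/andP => [[/andP[/andP[pD /forall_inP op] _] /eqP piE]|[pD /forall_inP op]].
  have CP : C \in C |: pi by rewrite setU11.
  have pDC := partitionD1 pD CP; rewrite piE in pDC; split=> //.
  apply/forall_inP => A Api.
  apply: contra (op A _) => [sA|]; last by rewrite in_setU1 Api orbT.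
  apply/subsetP => x xA; have := subsetP sA x xA.
  rewrite below_ord in_setU1 => /orP[/eqP xj|//].
  have : x \in D :\: C.
    by rewrite -(cover_partition pDC); apply/bigcupP; exists A.
  by rewrite xj inE jC.
have CN0 : C != set0 by apply/set0Pn; exists j.
have dis : [disjoint C & D :\: C].
  by rewrite disjoint_sym disjoints_subset setDE subsetIr.
have pDC : partition (C |: pi) D.
  by have := partitionU1 pD CN0 dis; rewrite setDE setUIr setUCr setIT (setUidPr CD).
have Cpi : C \notin pi.
  apply: contraL dis => Cpi; rewrite -(cover_partition pD).
  apply/negP => /bigcup_disjointP/(_ C Cpi); rewrite -setI_eq0 setIid; exact/negP.
split; last by rewrite setU1K.
rewrite /open_partition pDC /=; apply/andP; split.
  apply/forall_inP => A /setU1P[->|Api].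
    by apply/subsetPn; exists j; rewrite // inE ltnn.
  by apply: contra (op A Api) => /subset_trans; apply; apply: below_mono.
by apply/eqP/def_pblock; rewrite ?setU11 //; case/and3P: pDC.
Qed.

(** The factor for the cut at j depends only on whether an element is waiting.
  What remains is split according to whether j is the maximum of its block. If
  so, removing the block [j |: B] does not affect the cuts beyond j. *)
Lemma cut_sum_step :
  cut_sum D j = 2 ^ (#|D :&: below j| == 0) *
    (\sum_(B : {set 'I_n} | B \subset D :&: below j)
       cut_sum (D :\: (j |: B)) j.+1
     + cut_sum D j.+1).
Proof.
rewrite /cut_sum.
under eq_bigr => pi op do rewrite big_ltn ?ltn_ord // (cut_open op).
rewrite -big_distrr /=; congr (_ * _).
rewrite (bigID (fun pi => pblock pi j \subset below j.+1)) /=.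
congr (_ + _); last by apply: eq_bigl => pi; rewrite open_succ.
rewrite (partition_big (fun pi => pblock pi j :\ j)
  (fun B => B \subset D :&: below j)) /= => [|pi /andP[/andP[pD _] sj]].
  apply: eq_bigr => B sB.
  have jB : j \notin B.
    by apply/negP => /(subsetP sB); rewrite !inE ltnn andbF.
  rewrite (reindex_onto (fun pi => (j |: B) |: pi) (fun pi => pi :\ (j |: B))) /=.
    apply: eq_big => [pi|pi _].
      rewrite -open_close //; congr (_ && _).
      case op: (open_partition _ _ _) => //=.
      have jc : j \in pblock (j |: B |: pi) j.
        rewrite mem_pblock; case/andP: op => /cover_partition -> _; exact: jD.
      apply/andP/eqP => [[_ /eqP e]|->]; first by rewrite -[in RHS]e setD1K.
      rewrite setU1K //; split=> //.
      rewrite below_ord setUS //; exact: subset_trans sB (subsetIr _ _).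
    apply: eq_big_nat => c /andP[jc _]; rewrite cut_setU1 //.
    apply: subset_trans (below_mono _ jc).
    rewrite below_ord setUS //; exact: subset_trans sB (subsetIr _ _).
  move=> pi /andP[/andP[/andP[pD _] _] /eqP <-].
  have jc : j \in cover pi by rewrite (cover_partition pD).
  by rewrite [j |: _]setD1K ?mem_pblock // setD1K ?pblock_mem.
have jc : j \in cover pi by rewrite (cover_partition pD).
rewrite subsetI; apply/andP; split.
  rewrite -(cover_partition pD); apply: subset_trans (subD1set _ _) _.
  by apply: (bigcup_sup (pblock pi j)); rewrite ?pblock_mem.
by rewrite subDset -below_ord.
Qed.

End Step.

Lemma cut_sum_completions n (D : {set 'I_n}) j :
  j <= n -> ~: below j \subset D ->
  cut_sum D j = completions (n - j) #|D :&: below j|.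
Proof.
move: {-1}(n - j) (erefl (n - j)) => m; elim: m j D => [|m IH] j D mE jn sD.
  have {mE jn} jE : j = n by lia.
  rewrite /cut_sum /= jE below_all // setIT cards_eq0.
  rewrite (eq_bigl (fun pi => (pi == set0) && (D == set0))) => [|pi].
    case: eqP => D0 /=; last by rewrite big1 // => pi; rewrite andbF.
    by rewrite (big_pred1 set0) => [|pi]; rewrite ?andbT // big_geq.
  rewrite /open_partition below_all //.
  apply/andP/andP => [[pD /forall_inP op]|[/eqP-> /eqP->]].
    have pi0 : pi == set0.
      by apply/set0Pn => -[B /op]; rewrite subsetT.
    by rewrite pi0 -(cover_partition pD) (eqP pi0) /cover big_set0.
  by rewrite partition_set0 eqxx; split=> //; apply/forall_inP => B; rewrite inE.
have jn' : j < n by lia.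
have := @cut_sum_step n D (Ordinal jn') sD => /= ->.
rewrite [completions _ _]/=; set j' := Ordinal jn'; congr (_ * (_ + _)).
  rewrite -sum_over_subsets; apply: eq_bigr => B; rewrite subsetI => /andP[BD Bj].
  rewrite IH; [|lia|done|].
    congr (completions m #|pred_of_set _|); rewrite (below_ord j'); apply/setP => x.
    rewrite !inE -val_eqE /=; case: (ltngtP x j) => //= xj; rewrite ?andbF //.
    by rewrite !andbT.
  apply/subsetP => x; rewrite !inE -leqNgt => jx.
  rewrite -val_eqE /= gtn_eqF //= (subsetP sD) ?inE -?leqNgt 1?ltnW // andbT.
  apply/negP => /(subsetP Bj); rewrite inE; lia.
rewrite IH; [|lia|done|].
  congr (completions m _); rewrite (below_ord j') setIUr.
  have jD : j' \in D by apply: (subsetP sD); rewrite inE inE /= ltnn.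
  by rewrite (setIidPr _) ?sub1set // cardsU1 !inE /= ltnn andbF.
by apply: subset_trans sD; rewrite setCS; apply: below_mono.
Qed.

(** * Sequences of sequences *)

Section FlattenUniq.
Variable T : eqType.
Implicit Types (s : seq T) (ss : seq (seq T)).

Lemma flatten_uniq_eq ss s s' x :
  uniq (flatten ss) -> s \in ss -> s' \in ss -> x \in s -> x \in s' -> s = s'.
Proof.
elim: ss => //= r ss IH; rewrite cat_uniq => /and3P[_ /hasPn dis uss].
rewrite !inE => /orP[/eqP->|sin] /orP[/eqP->|sin'] xs xs' //; last exact: IH.
  have := dis x; rewrite -topredE /= xs; case/(_ _)/negP => //.
  by apply/flattenP; exists s'.
have := dis x; rewrite -topredE /= xs'; case/(_ _)/negP => //.
by apply/flattenP; exists s.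
Qed.

Lemma flatten_uniq_uniq ss :
  uniq (flatten ss) -> all (fun s => 0 < size s) ss -> uniq ss.
Proof.
elim: ss => //= r ss IH; rewrite cat_uniq => /and3P[_ /hasPn dis uss] /andP[r0 ss0].
rewrite IH // andbT; apply/negP => rss.
case: r r0 rss dis => // x r _ rss /(_ x).
rewrite -topredE /= inE eqxx /=; case/(_ _)/negP => //.
by apply/flattenP; exists (x :: r); rewrite // mem_head.
Qed.

End FlattenUniq.

Lemma flatten_levels (T : eqType) (f : T -> nat) k (s : seq T) :
  sorted (fun x y => f x <= f y) s -> all (fun x => f x < k) s ->
  flatten [seq [seq x <- s | f x == i] | i <- iota 0 k] = s.
Proof.
have tr : transitive (fun x y : T => f x <= f y) by move=> y x z; apply: leq_trans.
elim: k s => [|k IH] s sS; first by case: s {sS}.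
move=> lek; rewrite -addn1 iotaD map_cat flatten_cat /= cats0 add0n.
have -> : [seq [seq x <- s | f x == i] | i <- iota 0 k] =
          [seq [seq x <- [seq x <- s | f x < k] | f x == i] | i <- iota 0 k].
  apply/eq_in_map => i; rewrite mem_iota => /andP[_ ik].
  rewrite -filter_predI; apply: eq_filter => x /=.
  by case: eqP => // ->; rewrite ik.
rewrite IH ?filter_all //; last exact: sorted_filter.
elim: s sS lek {IH} => //= x s IH sS /andP[xk lek].
have [lt|ge] := ltnP (f x) k.
  by rewrite (ltn_eqF lt) /= IH // (path_sorted sS).
have xE : f x = k by apply/eqP; rewrite eqn_leq ge -ltnS xk.
rewrite xE eqxx /=.
have geS y : y \in s -> k <= f y.
  by move=> ys; rewrite -xE; move: y ys; apply/allP; exact: (order_path_min tr sS).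
have sE y : y \in s -> f y = k.
  by move=> ys; apply/eqP; rewrite eqn_leq geS // -ltnS (allP lek).
rewrite (_ : [seq y <- s | f y < k] = [::]).
  by congr (_ :: _); apply/all_filterP/allP => y /sE ->.
rewrite -(filter_pred0 s); apply: eq_in_filter => y /sE ->; exact: ltnn.
Qed.

(** * Components are cuts *)

Section Components.
Variables (n : nat) (pi : {set {set 'I_n}}).
Hypotheses (n0 : 0 < n) (pP : partition pi [set: 'I_n]).

Let tI : trivIset pi. Proof. by case/and3P: pP. Qed.

Lemma mem_blocks : blocks pi =i pi.
Proof. by move=> B; rewrite /blocks mem_sort mem_enum. Qed.

Lemma size_blocks : size (blocks pi) = #|pi|.
Proof. by rewrite /blocks size_sort -cardE. Qed.

Lemma uniq_blocks : uniq (blocks pi).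
Proof. by rewrite /blocks sort_uniq enum_uniq. Qed.

Lemma cover_mem (x : 'I_n) : exists2 B, B \in pi & x \in B.
Proof. by apply/bigcupP; rewrite -/(cover pi) (cover_partition pP) inE. Qed.

Lemma block_maxP (S : {set 'I_n}) :
  S != set0 -> exists2 x, x \in S & block_max S = x :> nat.
Proof.
by rewrite -card_gt0 => /(eq_bigmax_cond (fun x : 'I_n => val x)) [x xS xE]; exists x.
Qed.

(** For x < n this is the rank, counted from 0, of the component that contains
  x, since each cut in the interval [1, x] is the start of a new component. *)
Definition level (x : nat) : nat := \sum_(0 <= c < x) cut pi c.+1.

Lemma levelS x : level x.+1 = level x + cut pi x.+1.
Proof. by rewrite /level big_nat_recr. Qed.

Lemma level_mono x y : x <= y -> level x <= level y.
Proof. by move=> xy; rewrite /level [leqRHS](big_cat_nat (n := x)) ?leq_addr. Qed.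

(** A cut between two elements of a block would split the block. *)
Lemma level_block B (x y : 'I_n) :
  B \in pi -> x \in B -> y \in B -> level x = level y.
Proof.
move=> Bpi; wlog: x y / x <= y => [H xB yB|xy xB yB].
  by case/orP: (leq_total x y) => le; [|symmetry]; apply: (H _ _ le).
rewrite /level [RHS](big_cat_nat (n := x)) //= -[LHS]addn0.
congr (_ + _); rewrite big_nat big1 // => c /andP[xc cy].
apply/eqP; rewrite eqb0; apply/forall_inP => /(_ B Bpi) /orP[/subsetP/(_ y yB)|].
  by rewrite inE; lia.
by move=> /pred0P/(_ x); rewrite /= xB inE ltnS xc.
Qed.

Lemma level_onto m i : i <= level m -> exists2 x, x <= m & level x = i.
Proof.
elim: m => [|m IH].
  by rewrite /level big_geq // leqn0 => /eqP->; exists 0; rewrite ?big_geq.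
have [/IH[x xm xi] _|lt] := leqP i (level m); first by exists x; rewrite // ltnW.
move=> le; exists m.+1 => //; move: le lt; rewrite levelS; case: (cut _ _); lia.
Qed.

(** The level sets of [level] are the wanted unions. They are unions of blocks by
  [level_block] and intervals by monotonicity, none is empty because [level]
  grows by at most 1, and the list of blocks, being sorted by maxima, goes
  through them in order. *)
Lemma splits_level : splits pi (level n.-1).+1.
Proof.
move kE: (level n.-1).+1 => k.
pose f (B : {set 'I_n}) := level (block_max B).
pose ps := [seq [seq B <- blocks pi | f B == i] | i <- iota 0 k].
have fE (B : {set 'I_n}) x : B \in pi -> x \in B -> f B = level x.
  move=> Bpi xB; have /block_maxP[y yB yE] : B != set0 by apply/set0Pn; exists x.
  by rewrite /f yE; apply: level_block Bpi yB xB.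
have psE : flatten ps = blocks pi.
  apply: flatten_levels.
    apply: sub_sorted (sort_sorted _ _) => [B C|B C]; last exact: leq_total.
    exact: level_mono.
  apply/allP => B; rewrite mem_blocks => Bpi; rewrite -kE ltnS.
  have [x xB _] := block_maxP (partition_neq0 pP Bpi).
  by rewrite (fE B x) // level_mono // -ltnS prednK.
have szps : size ps = k by rewrite size_map size_iota.
have le_pi s : s \in ps -> size s < #|pi|.+1.
  by case/mapP=> i _ ->; rewrite ltnS -size_blocks size_filter count_size.
have szsh : size [seq (inord (size s) : 'I_#|pi|.+1) | s <- ps] == k.
  by rewrite size_map szps.
have lensE : [seq val l | l <- Tuple szsh] = shape ps.
  by rewrite -map_comp; apply/eq_in_map => s /le_pi sP; rewrite /= inordK.
apply/existsP; exists (Tuple szsh); cbv zeta; rewrite lensE.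
rewrite -psE size_flatten eqxx flattenK andTb; apply/andP; split.
  apply/allP => _ /mapP[_ /mapP[i + ->] ->]; rewrite mem_iota add0n -kE => /andP[_ ik].
  have [x xn xi] := @level_onto n.-1 i ik.
  have xn' : x < n by rewrite -(prednK n0) ltnS.
  have [B Bpi xB] := cover_mem (Ordinal xn').
  rewrite size_filter -has_count; apply/hasP; exists B; first by rewrite mem_blocks.
  by rewrite (fE B _ Bpi xB) /= xi.
apply/allP => _ /mapP[i _ ->].
have unE (x : 'I_n) :
    (x \in \bigcup_(B <- [seq B <- blocks pi | f B == i]) B) = (level x == i).
  rewrite bigcup_seq; apply/bigcupP/idP => [[B]|xi].
    by rewrite mem_filter mem_blocks => /andP[/eqP <- Bpi] xB; rewrite (fE B x).
  have [B Bpi xB] := cover_mem x.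
  by exists B => //; rewrite mem_filter mem_blocks Bpi (fE B x Bpi xB) xi.
apply/forall_inP => x; rewrite unE => /eqP xi.
apply/forall_inP => z; rewrite unE => /eqP zi.
apply/forallP => y; apply/implyP => /andP[/level_mono xy /level_mono yz].
by rewrite unE; lia.
Qed.

(** If M is the maximum of one of the k unions, then M + 1 is a cut: a block with
  elements on both sides would belong to another union, which as an interval
  would contain M. The unions are disjoint, so their maxima are distinct. *)
Lemma splits_leq k : splits pi k -> k <= \sum_(0 <= c < n) cut pi c.+1.
Proof.
case/existsP=> sh; set lens := map _ _ => /and3P[/allP lens0 /eqP lensE /allP ints].
set rs := reshape _ _ in ints.
have fE : flatten rs = blocks pi by apply: reshapeKr; rewrite lensE.
have shE : shape rs = lens by apply: reshapeKl; rewrite lensE.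
have rs0 s : s \in rs -> 0 < size s by move=> sin; apply: lens0; rewrite -shE map_f.
have uf : uniq (flatten rs) by rewrite fE uniq_blocks.
have memrs s B : s \in rs -> B \in s -> B \in pi.
  by move=> sin Bs; rewrite -mem_blocks -fE; apply/flattenP; exists s.
pose un (s : seq {set 'I_n}) := \bigcup_(B <- s) B.
have unP (s : seq {set 'I_n}) x : reflect (exists2 B, B \in s & x \in B) (x \in un s).
  by rewrite /un bigcup_seq; apply: bigcupP.
have un_inj s s' x : s \in rs -> s' \in rs -> x \in un s -> x \in un s' -> s = s'.
  move=> sin sin' /unP[B Bs xB] /unP[B' Bs' xB'].
  have BB' : B = B'.
    rewrite -(def_pblock tI (memrs _ _ sin Bs) xB).
    exact: def_pblock (memrs _ _ sin' Bs') xB'.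
  by apply: (flatten_uniq_eq uf sin sin' Bs); rewrite BB'.
have maxP s : s \in rs -> exists2 x, x \in un s & block_max (un s) = x :> nat.
  move=> sin; apply: block_maxP; case: s sin (rs0 _ sin) => // B s sin _.
  have /set0Pn[x xB] := partition_neq0 pP (memrs _ _ sin (mem_head _ _)).
  by apply/set0Pn; exists x; apply/unP; exists B; rewrite ?mem_head.
have <- : size [seq block_max (un s) | s <- rs] = k.
  by rewrite size_map -(size_map size) -/(shape rs) shE size_map size_tuple.
have -> : \sum_(0 <= c < n) cut pi c.+1 = size [seq c <- iota 0 n | cut pi c.+1].
  by rewrite size_filter -sum1_count /index_iota subn0 [RHS]big_mkcond.
apply: uniq_leq_size.
  rewrite map_inj_in_uniq; first by apply: flatten_uniq_uniq uf _; apply/allP.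
  move=> s s' sin sin'.
  have [x xs ->] := maxP _ sin; have [x' xs' ->] := maxP _ sin'.
  by move=> /val_inj E; apply: un_inj xs _; rewrite // E.
move=> _ /mapP[s sin ->]; have [M Ms ME] := maxP _ sin.
rewrite mem_filter mem_iota /= ME add0n ltn_ord andbT.
apply/forall_inP => B; rewrite -mem_blocks -fE => /flattenP[s' sin' Bs'].
have [es|ns] := eqVneq s' s.
  apply/orP; left; apply/subsetP => x xB; rewrite inE ltnS -ME.
  have xs : x \in un s by apply/unP; exists B; rewrite // -es.
  exact: (@leq_bigmax_cond _ _ (fun x : 'I_n => val x) x xs).
apply: contraNT ns; rewrite negb_or -setI_eq0 => /andP[/subsetPn[z zB zM] /set0Pn[x]].
rewrite !inE in zM *; case/andP=> xB xM.
have un' y : y \in B -> y \in un s' by move=> yB; apply/unP; exists B.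
have /forall_inP/(_ x (un' x xB))/forall_inP/(_ z (un' z zB)) := ints s' sin'.
move=> /forallP/(_ M)/implyP Ms'.
by apply/eqP/(un_inj _ _ M) => //; apply: Ms'; lia.
Qed.

(** [splits_leq] counts the ends c + 1 of the components and the present sum their
  starts; the two numbers agree because both 0 and n are cuts. *)
Lemma components_cuts : components pi = \sum_(0 <= c < n) cut pi c.
Proof.
have levE : (level n.-1).+1 = \sum_(0 <= c < n) cut pi c.
  rewrite (big_ltn n0) big_add1 -add1n; congr (_ + _).
  by rewrite cut0.
have levE' : \sum_(0 <= c < n) cut pi c.+1 = (level n.-1).+1.
  rewrite -/(level n) -[in level n](prednK n0) levelS prednK // -addn1.
  congr (_ + _).
  apply/eqP; rewrite eqb1; apply/forall_inP => B _.
  by rewrite below_all // subsetT.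
rewrite -levE; apply/eqP; rewrite eqn_leq /components; apply/andP; split.
  by apply/bigmax_leqP => k /splits_leq; rewrite levE'.
have ltk : (level n.-1).+1 < #|pi|.+1.
  have /existsP[sh /and3P[/allP lens0 /eqP lensE _]] := splits_level.
  rewrite ltnS -size_blocks -lensE.
  rewrite -{1}(size_tuple sh) -(size_map val) -sum1_size sumnE !big_seq.
  exact: leq_sum.
exact: (leq_bigmax_cond (Ordinal ltk) splits_level).
Qed.

End Components.

(** * Partitions weighted by their number of components *)

(** The number of components lies between 1 and n, so the range of k misses no
  partition. *)
Lemma sum_components n : 0 < n ->
  \sum_(1 <= k < n.+1) 2 ^ k * t n k = cut_sum [set: 'I_n] 0.
Proof.
move=> n0.
transitivity (\sum_(1 <= k < n.+1)
    \sum_(pi : {set {set 'I_n}} | partition pi [set: 'I_n])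
      if k == components pi then 2 ^ k else 0).
  apply: eq_bigr => k _; rewrite /t cardsE -sum1_card big_distrr /= -big_mkcondr /=.
  by apply: eq_big => [pi|pi _]; rewrite ?muln1 // unfold_in eq_sym.
rewrite exchange_big /= /cut_sum.
rewrite [RHS](eq_bigl (fun pi => partition pi [set: 'I_n])) => [|pi].
  apply: eq_bigr => pi pP; rewrite -big_mkcond big_nat1_eq components_cuts //.
  rewrite expn_sum ifT // ltnS; apply/andP; split.
    by rewrite (big_ltn n0) cut0.
  rewrite -[leqRHS]subn0 -[n - 0]muln1 -sum_nat_const_nat.
  by apply: leq_sum => c _; apply: leq_b1.
rewrite /open_partition; case pP: (partition _ _) => //=.
apply/forall_inP => B /(partition_neq0 pP) /set0Pn[x xB].
by apply/subsetPn; exists x; rewrite // inE.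
Qed.

Theorem theorem2p1 (n : nat) (hn : 1 <= n) :
  \sum_(1 <= k < n.+1) 2 ^ k * t n k =
  \sum_(P : (n.*2).-tuple bool | grand_dyck P)
    \prod_(i < size (heights_A P))
      'C((nth 0 (heights_A P) i).-1, nth 0 (heights_B P) i).
Proof.
rewrite sum_grand_dyck // sum_components // cut_sum_completions //.
by rewrite subn0 below0 setI0 cards0.
Qed.
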